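(* For each $n\in\mathbb{N}$, there is a finite non-abelian group whose commuting graph has clique number equal to $2n$.
   Context: Here $\mathbb{N}=\{1,2,3,\ldots\}$. The commuting graph of a finite non-abelian group $G$ is the simple graph with vertex set $G\setminus Z(G)$, where $Z(G)$ is the center of $G$ (so central elements, including the identity, are not vertices), in which two distinct vertices $x,y$ are adjacent if and only if $xy=yx$. The clique number of a finite simple graph is the maximum size of a set of pairwise adjacent vertices. *)

(* Defs.v *)
From mathcomp Require Import all_boot all_fingroup all_solvable.

Set Implicit Arguments.
Unset Strict Implicit.
Unset Printing Implicit Defensive.

Local Open Scope group_scope.

Record sgraph := SGraph {
  vertex : finType;
  adj : rel vertex;
  adj_sym : symmetric adj;
  adj_irrefl : irreflexive adj }.

Definition is_clique (g : sgraph) (A : {set vertex g}) : bool :=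
  [forall x in A, forall y in A, (x != y) ==> adj x y].

Definition clique_number (g : sgraph) : nat :=
  \max_(A : {set vertex g} | is_clique A) #|A|.

Section CommutingGraph.
Variables (gT : finGroupType) (G : {group gT}).

Definition noncentral : finType := {x : gT | x \in G :\: 'Z(G)}.

Definition commuting_adj : rel noncentral :=
  fun x y => (x != y) && (val x * val y == val y * val x).

Lemma commuting_adj_sym : symmetric commuting_adj.
Proof. by move=> x y; rewrite /commuting_adj eq_sym [val x * _ == _]eq_sym. Qed.

Lemma commuting_adj_irrefl : irreflexive commuting_adj.
Proof. by move=> x; rewrite /commuting_adj eqxx. Qed.

Definition commuting_graph : sgraph :=
  SGraph commuting_adj_sym commuting_adj_irrefl.

End CommutingGraph.

(* Main.v *)
(** In the dihedral group of order [2q] with [q = 2n + 1], inversion fixes no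
    nontrivial rotation, so a reflection commutes with no vertex other than
    itself: two distinct commuting reflections would differ by a nontrivial
    rotation commuting with both.  The maximum cliques are therefore formed by
    the [q - 1 = 2n] nontrivial rotations, the center being trivial. *)

Require Import Defs.
From mathcomp Require Import all_boot all_fingroup all_solvable.

Set Implicit Arguments.
Unset Strict Implicit.
Unset Printing Implicit Defensive.

Local Open Scope group_scope.

Lemma commuting_clique_commute (gT : finGroupType) (G : {group gT})
    (S : {set noncentral G}) (u v : noncentral G) :
  is_clique (g := commuting_graph G) S -> u \in S -> v \in S ->
  commute (val u) (val v).
Proof.
move=> /'forall_implyP/(_ u) clS Su Sv; have [-> //|neq_uv] := eqVneq u v.
have /forallP/(_ v) := clS Su; rewrite Sv neq_uv /= => /andP[_ /eqP].
exact.
Qed.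

Lemma noncentral_neq1 (gT : finGroupType) (G : {group gT}) (u : noncentral G) :
  val u != 1.
Proof. by have /setDP[_] := valP u; apply: contra => /eqP->; apply: group1. Qed.

Section FixedPointFreeIndexTwo.

Variables (gT : finGroupType) (G A : {group gT}).
Hypotheses (sAG : A \subset G) (iAG : #|G : A| = 2) (ntA : 1 < #|A|).
(** [A] abstracts the rotation subgroup: no element of [G] outside [A] commutes with a nontrivial
    element of [A]. *)
Hypothesis fpf : {in G :\: A, forall x, 'C_A[x] = 1}.

Lemma fpf_commute_eq1 x a : x \in G :\: A -> a \in A -> commute x a -> a = 1.
Proof.
move=> GAx Aa cxa; apply/set1gP.
by rewrite -(fpf GAx) inE Aa; apply/cent1P.
Qed.

Lemma setD_index2_rcoset x : x \in G :\: A -> G :\: A = A :* x.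
Proof.
move=> /setDP[Gx nAx]; apply/esym/eqP; rewrite eqEcard card_rcoset.
have -> : #|G :\: A| = #|A|.
  by rewrite cardsD (setIidPr sAG) -(Lagrange sAG) iAG muln2 -addnn addnK.
rewrite leqnn andbT; apply/subsetP=> _ /rcosetP[a Aa ->].
by rewrite inE groupMl // nAx groupM // (subsetP sAG).
Qed.

Lemma setD_index2_nonempty : exists x, x \in G :\: A.
Proof.
apply/set0Pn; rewrite setD_eq0; apply/negP => sGA.
by have := iAG; rewrite -indexgI (setIidPl sGA) indexgg.
Qed.

Lemma fpf_index2_nonabelian : ~~ abelian G.
Proof.
have [x GAx] := setD_index2_nonempty; apply/negP=> /centsP cGG.
have /trivgPn[a Aa /eqP[]] : A :!=: 1 by rewrite -cardG_gt1.
have /setDP[Gx _] := GAx; apply: (fpf_commute_eq1 GAx Aa _).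
exact: (cGG _ Gx _ (subsetP sAG _ Aa)).
Qed.

(** A central element inside [A] commutes with some element outside, so it is trivial; one outside
    [A] would commute with a nontrivial element of [A]. *)
Lemma fpf_index2_center : 'Z(G) = 1.
Proof.
have /trivgPn[a Aa nt_a] : A :!=: 1 by rewrite -cardG_gt1.
apply/trivgP/subsetP=> z /centerP[Gz cGz]; apply/set1gP.
have [Az | nAz] := boolP (z \in A).
  have [x GAx] := setD_index2_nonempty; have /setDP[Gx _] := GAx.
  by apply: (fpf_commute_eq1 GAx Az _); apply/commute_sym; apply: cGz.
have GAz : z \in G :\: A by rewrite inE nAz.
case/eqP: nt_a; apply: (fpf_commute_eq1 GAz Aa _).
by apply: cGz; apply: (subsetP sAG).
Qed.

Lemma fpf_index2_clique_outside (S : {set noncentral G}) u :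
    is_clique (g := commuting_graph G) S -> u \in S -> val u \notin A ->
  S \subset [set u].
Proof.
move=> clS Su nAu; have /setDP[Gu _] := valP u.
have GAu : val u \in G :\: A by rewrite inE nAu.
apply/subsetP=> v Sv; apply/set1P/val_inj.
have cuv := commuting_clique_commute clS Su Sv.
have /setDP[Gv _] := valP v.
(* A member of [A] commuting with [u] is 1, which is not a vertex. *)
have nAv : val v \notin A.
  by apply: contra (noncentral_neq1 v) => Av; apply/eqP; apply: (fpf_commute_eq1 GAu Av cuv).
have: val v \in G :\: A by rewrite inE nAv.
(* By index two, [v] lies in the coset of [u], so [v * u^-1] is in [A]; it commutes with [u], hence
   is 1. *)
rewrite (setD_index2_rcoset GAu) mem_rcoset => /(fpf_commute_eq1 GAu) vu1.
apply/eqP; rewrite eq_mulgV1; apply/eqP/vu1.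
by apply: commuteM => //; apply: commuteV.
Qed.

Lemma clique_number_fpf_index2 :
  abelian A -> clique_number (commuting_graph G) = #|A|.-1.
Proof.
move=> /centsP cAA.
have cardA1 : #|A^#| = #|A|.-1 by rewrite [in RHS](cardsD1 1) group1.
apply/eqP; rewrite eqn_leq; apply/andP; split.
  apply/bigmax_leqP => S clS.
  have [/exists_inP[u Su nAu] | /exists_inPn inA] :=
    boolP [exists u in S, val (u : noncentral G) \notin A].
    (* Such a clique has at most one vertex, and [1 <= #|A|.-1] because [A] is nontrivial. *)
    have /subset_leq_card := fpf_index2_clique_outside clS Su nAu.
    by move/leq_trans; apply; rewrite cards1 -ltnS prednK // ltnW.
  rewrite -cardA1 -(card_imset S (val_inj (sT := noncentral G))).
  apply/subset_leq_card/subsetP=> _ /imsetP[v Sv ->].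
  by rewrite !inE noncentral_neq1 /=; have := inA v Sv; rewrite negbK.
pose S : {set noncentral G} := [set u | val u \in A].
apply: (@leq_trans #|S|); last first.
  apply: (leq_bigmax_cond S); apply/'forall_implyP=> u; rewrite inE => Au.
  apply/'forall_implyP=> v; rewrite inE => Av; apply/implyP=> neq_uv.
  by apply/andP; split=> //; apply/eqP/cAA.
rewrite -cardA1 -(card_imset S (val_inj (sT := noncentral G))).
apply/subset_leq_card/subsetP=> a /setD1P[nt_a Aa].
(* As the center is trivial, every nontrivial element of [A] is a vertex, so none is lost in the
   count. *)
have GZa : a \in G :\: 'Z(G).
  by rewrite fpf_index2_center !inE nt_a (subsetP sAG).
by apply/imsetP; exists (Sub a GZa); rewrite ?inE SubK.
Qed.

End FixedPointFreeIndexTwo.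

(** Elements of the product outside [<[x]>] have the form [a * y] with [a] in [<[x]>], and act on
    the abelian group [<[x]>] by inversion. A fixed [b] thus satisfies [b ^+ 2 = 1], and odd order
    forces [b = 1]. *)
Lemma inverted_odd_cycle_fpf (gT : finGroupType) (x y : gT) :
    odd #[x] -> y ^+ 2 = 1 -> x ^ y = x^-1 ->
  {in <[x]> * <[y]> :\: <[x]>, forall g, 'C_<[x]>[g] = 1}.
Proof.
move=> odd_x y2 xy g /setDP[/mulsgP[a _ Xa /cycleP[i ->] ->] nXg].
apply/trivgP/subsetP=> b /setIP[Xb /cent1P cbg].
have yi : y ^+ i = y ^+ odd i.
  by rewrite -[in LHS](odd_double_half i) -mul2n expgD expgM y2 expg1n mulg1.
have odd_i : odd i.
  by apply: contraR nXg => /negbTE even_i; rewrite yi even_i mulg1.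
have by_inv : b ^ y = b^-1.
  by case/cycleP: Xb => k ->; rewrite conjXg xy expgVn.
have bV : b^-1 = b.
  have cab : commute b a by apply: (centsP (cycle_abelian x)).
  have /conjg_fixP : [~ b, a * y ^+ i] == 1 by apply/commgP.
  by rewrite yi odd_i conjgM (conjg_fixP (introT commgP cab)) by_inv.
apply/set1gP/eqP; rewrite -order_eq1 -dvdn1.
have <- : gcdn 2 #[x] = 1%N by apply/eqP; rewrite -/(coprime 2 _) coprime2n.
rewrite dvdn_gcd order_dvdn expgS expg1 -{1}bV mulVg eqxx /=.
exact: order_dvdG.
Qed.

Lemma odd_dihedral_structure (q : nat) : 1 < q -> odd q ->
  exists A : {group 'D_(q.*2)},
    [/\ abelian A, #|A| = q, #|'D_(q.*2) : A| = 2
      & {in 'D_(q.*2) :\: A, forall x, 'C_A[x] = 1}].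
Proof.
move=> q_gt1 odd_q; have q_gt0 := ltnW q_gt1.
have /existsP[[x y] /eqP[/= defG xq y2 xy]] := isoGrp_hom (Grp_dihedral q_gt1).
have nXY : <[y]> \subset 'N(<[x]>) by rewrite norms_cycle xy groupV cycle_id.
have mulG : <[x]> * <[y]> = 'D_(q.*2) by rewrite -norm_joinEr.
have dvd_xq : #[x] %| q by rewrite order_dvdn xq.
have le_y2 : #[y] <= 2 by rewrite dvdn_leq // order_dvdn y2.
(* The relations only bound the orders of [x] and [y] by [q] and 2; since the product of the two
   cycles has [2q] elements, [#[x]] cannot be smaller than [q]. *)
have card_x : #[x] = q.
  apply/eqP; rewrite eqn_leq dvdn_leq //= -leq_double.
  have := card_dihedral q_gt1; rewrite -mulG => oXY.
  have := leq_mul (leqnn #[x]) le_y2; rewrite muln2; apply: leq_trans.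
  by rewrite -[leqLHS]oXY !orderE mul_cardG leq_pmulr ?cardG_gt0.
exists <[x]>%G; split=> //; first exact: cycle_abelian.
  by rewrite -divgS ?subsetT // card_dihedral //= -orderE card_x -muln2 mulKn.
by rewrite -mulG; apply: inverted_odd_cycle_fpf; rewrite ?card_x.
Qed.

Local Close Scope group_scope.

Theorem theorem4p3 (n : nat) (hn : 0 < n) :
  exists (gT : finGroupType) (G : {group gT}),
    ~~ abelian G /\ clique_number (commuting_graph G) = 2 * n.
Proof.
have q_gt1 : 1 < n.*2.+1 by rewrite ltnS double_gt0.
have odd_q : odd n.*2.+1 by rewrite /= odd_double.
have [A [abA cardA iA fpfA]] := odd_dihedral_structure q_gt1 odd_q.
have ntA : 1 < #|A| by rewrite cardA.
exists _, ('D_(n.*2.+1.*2))%G; split.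
  exact: fpf_index2_nonabelian (subsetT _) iA ntA fpfA.
by rewrite (clique_number_fpf_index2 (subsetT _) iA ntA fpfA abA) cardA mul2n.
Qed.
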